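(* Let $(x,y,k)$ be a primitive solution of $y^2=x^3+k$ and put $u=(y+x^{3/2})/x$. If $|k|<u/2$, then $y/x$ is a convergent of the continued fraction of $\sqrt x$.
   Context: A solution is a triple $(x,y,k)$ of integers with $y^2=x^3+k$, $x\ge 1$, $y\ge 1$ and $k\ne 0$. It is primitive when $\gcd(x,y)=1$. Continued fractions are simple (regular) continued fractions. *)

(* Defs.v *)
From mathcomp Require Import all_boot all_order all_algebra.
From mathcomp Require Import all_classical all_reals all_analysis.
Import Order.TTheory GRing.Theory Num.Theory.

Set Implicit Arguments.
Unset Strict Implicit.
Unset Printing Implicit Defensive.

Local Open Scope ring_scope.

Definition is_solution (x y k : int) : Prop :=
  [/\ y ^+ 2 = x ^+ 3 + k, 1 <= x, 1 <= y & k != 0].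

Definition is_primitive (x y : int) : bool := coprimez x y.

(* The partial quotients a_0, ..., a_n of the regular continued fraction of
   [alpha].  The expansion stops at the first integral complete quotient, so
   for rational [alpha] the list may be shorter than n + 1. *)
Fixpoint partial_quotients (R : realType) (n : nat) (alpha : R) : seq int :=
  let a := Num.floor alpha in
  let f := alpha - a%:~R in
  a :: (if n is m.+1 then
          if f == 0 then [::] else partial_quotients m f^-1
        else [::]).

(* [a_0; a_1, ..., a_n], with the dummy value 0 on the empty list. *)
Fixpoint cf_value (R : realType) (s : seq int) : R :=
  match s with
  | [::] => 0
  | [:: a] => a%:~R
  | a :: s' => a%:~R + (cf_value R s')^-1
  end.

Definition is_convergent (R : realType) (r alpha : R) : Prop :=
  exists n : nat, r = cf_value R (partial_quotients n alpha).

(* Main.v *)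
(** Writing [1 = p' q - p q'] up to sign, with [0 <= q' <= q], every real is
    [alpha = (p t + p' s) / (q t + q' s)] for some [(t, s)]; the fraction [p / q]
    is a convergent of [alpha] as soon as [0 <= s < t], because this form is
    stable under the Gauss map (by Euclid's algorithm on both columns).
    Legendre's criterion [|alpha - p / q| < 1 / (2 q^2)] provides such a pair
    once the sign is that of [q alpha - p], and it holds here since
    [sqrt x - y / x = - k / (x^2 u)]. *)
Require Import Defs.
From mathcomp Require Import all_boot all_order all_algebra.
From mathcomp Require Import all_classical all_reals all_analysis.
From mathcomp Require Import zify ring lra.
Import Order.TTheory GRing.Theory Num.Theory.
Local Open Scope ring_scope.

Lemma floor_addz_frac (R : realType) (a : int) (f alpha : R) :
  alpha = a%:~R + f -> 0 <= f < 1 -> Num.floor alpha = a.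
Proof.
move=> -> /andP[f0 f1]; apply: floor_def.
by rewrite intrD lerDl f0 ltrD2l.
Qed.

Lemma is_convergent_floor (R : realType) (a : int) (f alpha : R) :
  alpha = a%:~R + f -> 0 <= f < 1 -> is_convergent a%:~R alpha.
Proof. by move=> E /(floor_addz_frac _ _ _ _ E) <-; exists 0%N. Qed.

Lemma is_convergent_gauss (R : realType) (a : int) (f r alpha : R) :
  alpha = a%:~R + f -> 0 < f < 1 ->
  is_convergent r f^-1 -> is_convergent (a%:~R + r^-1) alpha.
Proof.
move=> E /andP[f0 f1] [n rE]; exists n.+1.
have fl : Num.floor alpha = a by apply: (floor_addz_frac _ _ f) => //; rewrite ltW.
have -> : partial_quotients n.+1 alpha = a :: partial_quotients n f^-1.
  rewrite /= fl; have -> : alpha - a%:~R = f by rewrite E addrC addKr.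
  by rewrite gt_eqF.
(* [cf_value] treats a singleton apart; splitting on [n] exposes the tail as a nonempty list. *)
by rewrite rE; case: n {rE}.
Qed.

(* For [q = 1] and [q' = 0] the sign [-1] would give [alpha = p - s / t], which
   does not have [p] as a convergent; hence the last hypothesis on [q']. *)
Lemma is_convergent_moebius (R : realType) (p q p' q' e : int) (t s alpha : R) :
  p' * q - p * q' = e -> (e == 1) || (e == -1) ->
  0 < q -> 0 <= q' <= q -> (0 < q') || (e == 1) ->
  0 <= s < t -> alpha * (q%:~R * t + q'%:~R * s) = p%:~R * t + p'%:~R * s ->
  is_convergent (p%:~R / q%:~R) alpha.
Proof.
have [n] := ubnP `|q|%N.
elim: n => // n IHn in p q p' q' e alpha *.
move=> qn dete e1 q0 /andP[q'0 q'q] nbad /andP[s0 st] alphaE.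
have t0 : 0 < t by apply: le_lt_trans st.
have [q1|qn1] := eqVneq q 1.
  subst q; rewrite mulr1 in dete; rewrite mul1r in alphaE.
  rewrite divr1.
  have [q'E|q'E] : q' = 0 \/ q' = 1 by lia.
    subst q'; have p'E : p' = 1 by lia.
    subst p'; rewrite mul0r addr0 mul1r in alphaE.
    have E : alpha = p%:~R + s / t.
      by apply: (mulIf (lt0r_neq0 t0)); rewrite alphaE mulrDl divfK ?lt0r_neq0.
    apply: (is_convergent_floor _ _ _ _ E).
    by rewrite divr_ge0 ?(ltW t0) //= ltr_pdivrMr ?mul1r.
  subst q'; rewrite mul1r in alphaE.
  have ts0 : 0 < t + s by rewrite ltr_wpDr.
  have tsN := lt0r_neq0 ts0.
  have E : alpha = p%:~R + e%:~R * s / (t + s).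
    apply: (mulIf tsN); rewrite alphaE mulrDl divfK //.
    have -> : p' = p + e by lia.
    by rewrite intrD; ring.
  have [sE|sN] := eqVneq s 0.
    apply: (is_convergent_floor _ _ _ _ E).
    by rewrite sE mulr0 mul0r lexx ltr01.
  have s1 : 0 < s by rewrite lt0r sN.
  case/orP: e1 => /eqP eE; rewrite eE in E.
    rewrite mul1r in E.
    apply: (is_convergent_floor _ _ _ _ E).
    by rewrite divr_ge0 ?(ltW ts0) //= ltr_pdivrMr // mul1r ltrDr.
  (* With [e = -1], [alpha] lies below [p] by less than 1: its floor is [p - 1], and [p] appears one
     level later as [(p - 1) + 1 / 1]. *)
  have E1 : alpha = (p - 1)%:~R + t / (t + s).
    by rewrite E intrB; field.
  have E2 : (t / (t + s))^-1 = 1%:~R + s / t.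
    by field; rewrite tsN lt0r_neq0.
  have -> : p%:~R = (p - 1)%:~R + (1%:~R : R)^-1 by rewrite invr1 intrB subrK.
  apply: (is_convergent_gauss _ _ _ _ _ E1).
    by rewrite divr_gt0 //= ltr_pdivrMr // mul1r ltrDl.
  apply: (is_convergent_floor _ _ _ _ E2).
  by rewrite divr_ge0 ?(ltW t0) //= ltr_pdivrMr ?mul1r.
have q2 : 2 <= q by lia.
(* Subtracting [a] and inverting turns the columns [(p, q)], [(p', q')] into [(q, r)], [(q', r')];
   [t] and [s] stay, and the determinant changes sign. *)
pose a := (p %/ q)%Z; pose r := (p %% q)%Z; pose r' := p' - a * q'.
have pE : p = a * q + r by exact: divz_eq.
have p'E : p' = a * q' + r' by rewrite /r' addrC subrK.
have r_ge0 : 0 <= r by apply: modz_ge0; lia.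
have r_lt : r < q by apply: ltz_pmod.
clearbody a r r'; subst p p'.
have detr : q' * r - q * r' = - e by rewrite -dete; ring.
have {}e1 : e = 1 \/ e = -1 by lia.
have r'sgn : r' <= -1 \/ r' = 0 \/ 1 <= r' by lia.
(* If [q'] or [r] vanished, [q >= 2] would divide the unit [e]. *)
have q'1 : 1 <= q'.
  have [q'0E|//] : q' = 0 \/ 1 <= q' by lia.
  by subst q'; rewrite mul0r sub0r in detr; intuition nia.
have r1 : 1 <= r.
  have [r0E|//] : r = 0 \/ 1 <= r by lia.
  by subst r; rewrite mulr0 sub0r in detr; intuition nia.
(* The bounds follow from [q r' = q' r + e] with [q' r >= 1]; for [e = 1] this forces [r' > 0], so
   the excluded case never arises later. *)
have r'0 : 0 <= r' by nia.
have r'r : r' <= r by nia.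
have r'q' : r' <= q' by nia.
have rbad : (0 < r') || (- e == 1) by case: e1 => ?; subst e; nia.
have den0 : 0 < q%:~R * t + q'%:~R * s.
  by rewrite ltr_wpDr ?mulr_gt0 ?mulr_ge0 ?ler0z ?ltr0z.
have num0 : 0 < r%:~R * t + r'%:~R * s.
  by rewrite ltr_wpDr ?mulr_gt0 ?mulr_ge0 ?ler0z ?ltr0z.
have lt_nd : r%:~R * t + r'%:~R * s < q%:~R * t + q'%:~R * s.
  by rewrite ltr_leD ?ltr_pM2r ?ler_wpM2r ?ltr_int ?ler_int.
pose f : R := (r%:~R * t + r'%:~R * s) / (q%:~R * t + q'%:~R * s).
have E : alpha = a%:~R + f.
  apply: (mulIf (lt0r_neq0 den0)); rewrite alphaE mulrDl divfK ?lt0r_neq0 //.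
  by rewrite !intrD !intrM; ring.
have -> : (a * q + r)%:~R / q%:~R = a%:~R + (q%:~R / r%:~R : R)^-1.
  rewrite intrD intrM; field.
  by rewrite !intr_eq0; lia.
apply: (is_convergent_gauss _ _ _ _ _ E).
  by rewrite divr_gt0 //= ltr_pdivrMr // mul1r.
apply: (IHn q r q' r' (- e)) => //; try lia.
by rewrite invf_div divfK ?lt0r_neq0.
Qed.

(** Bezout columns may be shifted by multiples of [(p, q)]. The window for [q'] omits 0 rather than
    [q], which avoids the bad case [q' = 0] for either sign [e]. *)
Lemma bezout_column (p q e : int) : 0 < q -> coprimez p q ->
  exists p' q' : int, p' * q - p * q' = e /\ 0 < q' <= q.
Proof.
move=> q0 /coprimezP[[u v] /= uv].
(* This is [(e v, - e u)] plus [1 + (e u %/ q)] times [(p, q)]. *)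
exists (p * (1 + (e * u %/ q)%Z) + e * v), (q - (e * u %% q)%Z).
have modE := divz_eq (e * u) q.
have := ltz_pmod (e * u) q0; have := modz_ge0 (e * u) (lt0r_neq0 q0).
split; last by lia.
transitivity (e * (u * p + v * q)); last by rewrite uv mulr1.
have -> : (e * u %% q)%Z = e * u - (e * u %/ q)%Z * q.
  by rewrite {2}modE addrC addKr.
by ring.
Qed.

Lemma legendre_convergent (R : realType) (p q : int) (alpha : R) :
  0 < q -> coprimez p q ->
  `|alpha - p%:~R / q%:~R| < (2%:R * q%:~R ^+ 2)^-1 ->
  is_convergent (p%:~R / q%:~R) alpha.
Proof.
move=> q0 cop close.
pose d : R := q%:~R * alpha - p%:~R.
pose e : int := if 0 <= d then 1 else -1.
have qR : 0 < q%:~R :> R by rewrite ltr0z.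
have [p' [q' [dete /andP[q'0 q'q]]]] := bezout_column p q e q0 cop.
have e1 : (e == 1) || (e == -1) by rewrite /e; case: ifP.
have sE : e%:~R * d = `|d|.
  rewrite /e; case: (ger0P d) => _; first by rewrite mul1r.
  by rewrite mulrN1z mulN1r.
clearbody e.
have eR : e%:~R * e%:~R = 1 :> R.
  by rewrite -intrM; case/orP: e1 => /eqP ->.
(* Cramer's rule for [q t + q' s = 1], [p t + p' s = alpha], of determinant [e]; taking [e] as the
   sign of [d] makes [s] nonnegative. *)
pose s := e%:~R * d; pose t := e%:~R * (p'%:~R - q'%:~R * alpha).
have s_lt : 2%:R * q%:~R * s < 1.
  have -> : s = q%:~R * `|alpha - p%:~R / q%:~R|.
    rewrite /s sE -{1}(gtr0_norm qR) -normrM mulrBr mulrCA divff ?mulr1 //.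
    exact: lt0r_neq0.
  move: close; rewrite -[ltRHS]div1r ltr_pdivlMr ?mulr_gt0 ?exprn_gt0 //.
  by rewrite expr2; lra.
have s0 : 0 <= s by rewrite /s sE.
have deteR : p'%:~R * q%:~R - p%:~R * q'%:~R = e%:~R :> R.
  by rewrite -!intrM -intrB dete.
have den1 : q%:~R * t + q'%:~R * s = 1.
  by rewrite -[RHS]eR -{2}deteR /t /s /d; ring.
have q'qR : q'%:~R <= q%:~R :> R by rewrite ler_int.
apply: (is_convergent_moebius R p q p' q' e t s) => //.
- by rewrite (ltW q'0).
- by rewrite q'0.
(* From [q s < 1/2] and [q' <= q], [q t = 1 - q' s > 1/2 > q s]. *)
- rewrite s0 -(ltr_pM2l qR) /=.
  have : q'%:~R * s <= q%:~R * s by rewrite ler_wpM2r.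
  lra.
- rewrite den1 mulr1; transitivity (e%:~R * e%:~R * alpha).
    by rewrite eR mul1r.
  by rewrite -{2}deteR /t /s /d; ring.
Qed.

Theorem proposition5p1 (R : realType) (x y k : int)
  (hsol : is_solution x y k) (hprim : is_primitive x y) (u : R)
  (hu : u = (y%:~R + x%:~R `^ (3%:R / 2%:R)) / x%:~R)
  (hk : `|k|%:~R < u / 2%:R) :
  is_convergent (y%:~R / x%:~R : R) (Num.sqrt x%:~R).
Proof.
case: hsol => solE x1 y1 _.
have x0 : 0 < x%:~R :> R by rewrite ltr0z; lia.
have y0 : 0 < y%:~R :> R by rewrite ltr0z; lia.
pose w : R := Num.sqrt x%:~R.
have w0 : 0 < w by rewrite sqrtr_gt0.
have w2 : x%:~R = w ^+ 2 by rewrite sqr_sqrtr // ltW.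
have w3 : x%:~R `^ (3%:R / 2%:R) = w ^+ 3.
  by rewrite mulrC powRrM powR12_sqrt ?(ltW x0) // powR_mulrn ?ltW.
have kR : k%:~R = (y%:~R - w ^+ 3) * (y%:~R + w ^+ 3) :> R.
  have -> : k = y ^+ 2 - x ^+ 3 by rewrite solE addrC addKr.
  by rewrite intrB !rmorphXn /= w2; ring.
apply: legendre_convergent; [lia | by rewrite coprimez_sym |].
have S0 : 0 < y%:~R + w ^+ 3 by rewrite addr_gt0 ?exprn_gt0.
move: hk; rewrite hu w3 intr_norm kR normrM (gtr0_norm S0) w2 => hk'.
have -> : Num.sqrt (w ^+ 2) - y%:~R / w ^+ 2 = - (y%:~R - w ^+ 3) / w ^+ 2.
  by rewrite sqrtr_sqr gtr0_norm //; field; rewrite lt0r_neq0.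
rewrite normrM normrN (gtr0_norm (x := (w ^+ 2)^-1)) ?invr_gt0 ?exprn_gt0 //.
(* Multiplied by [y + w ^+ 3] and then by [x = w ^+ 2], Legendre's bound becomes exactly
   [|k| < u / 2]. *)
rewrite -(ltr_pM2r S0) mulrAC.
rewrite ltr_pdivrMr ?exprn_gt0 //.
apply: lt_le_trans hk' _.
by rewrite le_eqVlt; apply/orP; left; apply/eqP; field; rewrite lt0r_neq0.
Qed.
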